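(* Let $k \ge 3$ be an integer and let $G$ be a connected $k$-regular graph of order $n$ that is isomorphic neither to $K_{k+1}$ nor to $\overline{2C_4}$. Then $$\gamma_{\rm gr}(G) \ge \frac{n + \lceil \frac{k}{2} \rceil - 2}{k-1}.$$
   Context: Graphs are finite and simple; the order of a graph is its number of vertices. $N_G(v)$ is the set of neighbors of $v$ and $N_G[v]=N_G(v)\cup\{v\}$ is the closed neighborhood. A sequence $(v_1,\ldots,v_m)$ of vertices of $G$ is a closed neighborhood sequence if for every $i\in\{2,\ldots,m\}$, $N_G[v_i]\setminus\bigcup_{j=1}^{i-1}N_G[v_j]\neq\emptyset$. The Grundy domination number $\gamma_{\rm gr}(G)$ is the maximum length of a closed neighborhood sequence in $G$. $\overline{H}$ denotes the complement of a graph $H$, and $2C_4$ is the disjoint union of two copies of the cycle $C_4$ (so $\overline{2C_4}$ is a 5-regular graph on 8 vertices). *)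

(* Defs.v *)
From mathcomp Require Import all_boot all_order all_algebra.

Set Implicit Arguments.
Unset Strict Implicit.
Unset Printing Implicit Defensive.

(** * Finite simple graphs *)

Record sgraph := SGraph {
  vertex :> finType;
  adj : rel vertex;
  adj_sym : symmetric adj;
  adj_irr : irreflexive adj }.

Definition open_nbhd (G : sgraph) (v : G) : {set G} := [set w | adj v w].

Definition closed_nbhd (G : sgraph) (v : G) : {set G} := v |: open_nbhd v.

Definition regular (k : nat) (G : sgraph) : Prop :=
  forall v : G, #|open_nbhd v| = k.

(** The graph with no vertices does not count as connected. *)
Definition connected_graph (G : sgraph) : Prop :=
  0 < #|G| /\ forall v w : G, connect (@adj G) v w.

Definition isomorphic (G H : sgraph) : Prop :=
  exists2 f : G -> H, bijective f & forall v w : G, adj (f v) (f w) = adj v w.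

(** * Constructions *)

Section Complete.
Variable n : nat.
Let e : rel 'I_n := [rel i j | i != j].
Fact complete_sym : symmetric e.
Proof. by move=> i j; rewrite /e /= eq_sym. Qed.
Fact complete_irr : irreflexive e.
Proof. by move=> i; rewrite /e /= eqxx. Qed.
Definition complete_graph : sgraph := SGraph complete_sym complete_irr.
End Complete.

(** [cycle_graph n] is the cycle [C_n] for [3 <= n]; the condition [i != j]
    only matters for [n = 1], where it removes the loop. *)
Section Cycle.
Variable n : nat.
Let e : rel 'I_n :=
  [rel i j | (i != j) && ((j == ordS i) || (i == ordS j))].
Fact cycle_sym : symmetric e.
Proof. by move=> i j; rewrite /e /= eq_sym orbC. Qed.
Fact cycle_irr : irreflexive e.
Proof. by move=> i; rewrite /e /= eqxx. Qed.
Definition cycle_graph : sgraph := SGraph cycle_sym cycle_irr.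
End Cycle.

Section DisjointUnion.
Variables G H : sgraph.
Let e : rel (G + H) := fun u v =>
  match u, v with
  | inl x, inl y => adj x y
  | inr x, inr y => adj x y
  | _, _ => false
  end.
Fact disjoint_union_sym : symmetric e.
Proof. by case=> x [] y //=; rewrite adj_sym. Qed.
Fact disjoint_union_irr : irreflexive e.
Proof. by case=> x /=; rewrite adj_irr. Qed.
Definition disjoint_union : sgraph :=
  SGraph disjoint_union_sym disjoint_union_irr.
End DisjointUnion.

Section Complement.
Variable G : sgraph.
Let e : rel G := [rel v w | (v != w) && ~~ adj v w].
Fact complement_sym : symmetric e.
Proof. by move=> v w; rewrite /e /= eq_sym adj_sym. Qed.
Fact complement_irr : irreflexive e.
Proof. by move=> v; rewrite /e /= eqxx. Qed.
Definition complement : sgraph := SGraph complement_sym complement_irr.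
End Complement.

Definition two_C4 : sgraph := disjoint_union (cycle_graph 4) (cycle_graph 4).

(** * Grundy domination number *)

(** Indices start at 0, so the condition concerns [i = 1, ..., m - 1]. *)
Definition closed_nbhd_seq (G : sgraph) (m : nat) (s : m.-tuple G) : bool :=
  [forall i : 'I_m, (0 < i) ==>
    (closed_nbhd (tnth s i)
       :\: \bigcup_(j < m | j < i) closed_nbhd (tnth s j) != set0)].

(** The bound [#|G|] on the length loses nothing, see [closed_nbhd_seq_size]. *)
Definition grundy_dom (G : sgraph) : nat :=
  \max_(m < #|G|.+1 | [exists s : m.-tuple G, closed_nbhd_seq s]) m.

Lemma closed_nbhd_seq_size (G : sgraph) (m : nat) (s : m.-tuple G) :
  closed_nbhd_seq s -> m <= #|G|.
Proof.
move=> /forallP cns_s; suff inj_s : injective (tnth s).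
  by rewrite -[m]card_ord; apply: leq_card inj_s.
have lt_neq (i j : 'I_m) : j < i -> tnth s i <> tnth s j.
  move=> lt_ji eq_ij; have := cns_s i.
  rewrite (leq_ltn_trans (leq0n j) lt_ji) /=.
  by rewrite eq_ij setD_eq0 (bigcup_sup j).
move=> i j eq_ij; apply: val_inj.
by case: (ltngtP i j) => // [/lt_neq | /lt_neq]; rewrite eq_ij.
Qed.

Lemma leq_grundy_dom (G : sgraph) (m : nat) (s : m.-tuple G) :
  closed_nbhd_seq s -> m <= grundy_dom G.
Proof.
move=> cns_s; have lt_m : m < #|G|.+1 by rewrite ltnS (closed_nbhd_seq_size cns_s).
by apply: (leq_bigmax_cond (Ordinal lt_m)); apply/existsP; exists s.
Qed.

Lemma grundy_dom_attained (G : sgraph) :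
  exists s : (grundy_dom G).-tuple G, closed_nbhd_seq s.
Proof.
have nil_ok : [exists s : 0.-tuple G, closed_nbhd_seq s].
  by apply/existsP; exists [tuple]; apply/forallP=> -[].
rewrite /grundy_dom.
by have [m /existsP ex_s ->] := eq_bigmax_cond
  (A := [pred m : 'I_#|G|.+1 | [exists s : m.-tuple G, closed_nbhd_seq s]])
  (fun m : 'I_#|G|.+1 => m : nat) (introT card_gt0P (ex_intro _ ord0 nil_ok)).
Qed.

(* Main.v *)
Require Import Defs.
From mathcomp Require Import all_boot all_order all_algebra zify.

Set Implicit Arguments.
Unset Strict Implicit.
Unset Printing Implicit Defensive.
Import Order.TTheory GRing.Theory Num.Theory.

(** Write [n] for the order of [G], [m] for its Grundy domination number, and
    let the cost of a term of a closed neighborhood sequence be the number of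
    vertices that it dominates first. The first term costs [k + 1]. As long as
    the dominated set is not everything, connectedness gives a dominated vertex
    [v] with an undominated neighbor; [v] and a term of the sequence that
    dominates it are two dominated vertices of [N[v]], so [v] can be appended at
    cost at most [k - 1]. This yields [n <= (k + 1) + (k - 1)(m - 1)], and the
    theorem asks to save another [uphalf k] on these costs.

    The savings are made at both ends. Always append a vertex of least positive
    cost, and stop when the undominated set [T] is indivisible: every closed
    neighborhood contains it or misses it ([greedy_extension]). Then one more
    term dominates [T], and the vertices of [T] are pairwise closed twins, i.e.
    they have the same closed neighborhood ([indivisible_sub_twin_class]). Start
    at a vertex [u] whose twin class has the largest size [a], followed by a
    neighbor [w] of [u] with [N[w]] not inside [N[u]]; since [N[w]] contains the
    twins of [u] as well as [w], the second term costs at most [k - a]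
    ([exists_cheap_start]). The last term costs [#|T| <= a], so the total saving
    is at least [(a - 1) + (k - 1 - a) = k - 2]. This is at least [uphalf k]
    for [k >= 4]. For [k = 3] it is one too small, and then the
    bound [n <= 2m + 1] so obtained improves to [n <= 2m] because a cubic graph
    has an even number of vertices ([regular_handshake]).

    This argument needs a vertex that [u] and [w] leave undominated. If there is
    none, then [n <= 2k + 1 - a], and the bound holds as soon as some sequence
    has length three. If none has, the complement of each closed neighborhood is
    indivisible, and it is a twin class ([twin_class_non_nbhd]). So [V] is
    partitioned into twin classes of size [p = n - 1 - k], hence [p] divides [n].
    With [n <= 2k + 1 - p] and [n * k] even, the bound can only fail for [p = 2],
    [k = 5], [n = 8], and this graph is the complement of [2C_4]
    ([grundy_lower_bound_dense], [isomorphic_complement_2C4]). *)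

(** * Closed neighborhoods and footprinting sequences *)

Lemma in_closed_nbhd (G : sgraph) (v w : G) :
  (w \in closed_nbhd v) = (w == v) || adj v w.
Proof. by rewrite !inE. Qed.

Lemma closed_nbhd_sym (G : sgraph) (v w : G) :
  (w \in closed_nbhd v) = (v \in closed_nbhd w).
Proof. by rewrite !in_closed_nbhd eq_sym adj_sym. Qed.

Lemma closed_nbhd_id (G : sgraph) (v : G) : v \in closed_nbhd v.
Proof. by rewrite in_closed_nbhd eqxx. Qed.

Lemma card_closed_nbhd (k : nat) (G : sgraph) (v : G) :
  regular k G -> #|closed_nbhd v| = k.+1.
Proof. by move=> reg; rewrite cardsU1 inE adj_irr reg. Qed.

(** The accumulated dominated set [D] allows a sequence to be continued term by
    term, which the condition on tuples in [closed_nbhd_seq] does not. *)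
Fixpoint footprinting (G : sgraph) (D : {set G}) (s : seq G) : bool :=
  if s is v :: s' then
    ~~ (closed_nbhd v \subset D) && footprinting (D :|: closed_nbhd v) s'
  else true.

Lemma footprinting_nth (G : sgraph) (D : {set G}) (s : seq G) (x : G)
    (i : nat) :
    footprinting D s -> i < size s ->
  ~~ (closed_nbhd (nth x s i)
        \subset D :|: \bigcup_(j < i) closed_nbhd (nth x s j)).
Proof.
elim: s D i => [|v s IHs] D [|i] //= /andP[new_v fp_s] lt_i.
  by rewrite big_ord0 setU0.
by rewrite big_ord_recl setUA; apply: IHs.
Qed.

Lemma footprinting_leq_grundy (G : sgraph) (s : seq G) :
  footprinting set0 s -> size s <= grundy_dom G.
Proof.
move=> fp_s; apply: (@leq_grundy_dom G (size s) (in_tuple s)).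
apply/forallP=> i; apply/implyP=> _; rewrite setD_eq0.
have x := tnth (in_tuple s) i.
apply: contra (footprinting_nth x fp_s (ltn_ord i)); rewrite set0U.
rewrite (tnth_nth x) => /subset_trans; apply.
apply/bigcupsP=> j lt_ji; rewrite (tnth_nth x).
exact: (bigcup_sup (Ordinal lt_ji)).
Qed.

Definition dom_set (G : sgraph) (S : {set G}) : {set G} :=
  \bigcup_(v in S) closed_nbhd v.

(** * Indivisible sets and closed twins *)

Definition indivisible (G : sgraph) (T : {set G}) : bool :=
  [forall v : G, (T \subset closed_nbhd v) || [disjoint closed_nbhd v & T]].

Definition twin_class (G : sgraph) (x : G) : {set G} :=
  [set y | closed_nbhd y == closed_nbhd x].

(** If [y] and [z] lie in [T] and [v] is in [N[y]], then [N[v]] meets [T] in [y],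
    so it contains [z], that is, [v] is in [N[z]]. *)
Lemma indivisible_sub_twin_class (G : sgraph) (T : {set G}) (x : G) :
  indivisible T -> x \in T -> T \subset twin_class x.
Proof.
move=> /forallP unsT; have nbhd_sub (y z : G) :
    y \in T -> z \in T -> closed_nbhd y \subset closed_nbhd z.
  move=> Ty Tz; apply/subsetP=> v; rewrite closed_nbhd_sym => vy.
  case/orP: (unsT v) => [/subsetP/(_ z Tz)|/pred0P/(_ y)].
    by rewrite closed_nbhd_sym.
  by rewrite /= vy Ty.
by move=> Tx; apply/subsetP=> y Ty; rewrite inE eqEsubset !nbhd_sub.
Qed.

(** * The greedy extension *)

Lemma exists_boundary_edge (G : sgraph) (A : {set G}) :
    connected_graph G -> A != set0 -> A != setT ->
  exists2 x, x \in A & exists2 y, y \notin A & adj x y.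
Proof.
move=> [_ conn] /set0Pn[a Aa] AT.
have [/existsP[x /andP[Ax /existsP[y /andP[]]]]|noedge] :=
    boolP [exists x, (x \in A) && [exists y, (y \notin A) && adj x y]].
  by exists x => //; exists y.
case/negP: AT; apply/eqP/setP=> b; rewrite inE -Aa.
apply/esym/(closed_connect _ (conn a b)).
apply: intro_closed => [|x y xy Ax]; first exact: (sym_connect_sym (@adj_sym G)).
apply/negPn/negP=> nAy; case/negP: noedge; apply/existsP; exists x.
by rewrite Ax; apply/existsP; exists y; rewrite nAy.
Qed.

(** A dominated vertex [v] with an undominated neighbor is not in [S], so [v]
    and a vertex of [S] dominating it are distinct, and both are dominated
    members of [N[v]]. *)
Lemma exists_cheap_footprinter (k : nat) (G : sgraph) (S : {set G}) :
    connected_graph G -> regular k G -> S != set0 -> dom_set S != setT ->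
  exists2 v, ~~ (closed_nbhd v \subset dom_set S)
           & #|closed_nbhd v :\: dom_set S| <= k.-1.
Proof.
move=> conn reg /set0Pn[s0 Ss0] ST.
have S0 : dom_set S != set0.
  by apply/set0Pn; exists s0; apply/bigcupP; exists s0; rewrite ?closed_nbhd_id.
have [v /bigcupP[s Ss vs] [y nDy vy]] := exists_boundary_edge conn S0 ST.
have vy' : y \in closed_nbhd v by rewrite in_closed_nbhd vy orbT.
exists v; first by apply/subsetPn; exists y.
have neq_vs : v != s.
  by apply: contra nDy => /eqP eq_vs; apply/bigcupP; exists s; rewrite // -eq_vs.
have sub2 : [set v; s] \subset closed_nbhd v :&: dom_set S.
  apply/subsetP=> z /set2P[]->; rewrite inE.
    by rewrite closed_nbhd_id; apply/bigcupP; exists s.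
  by rewrite closed_nbhd_sym vs; apply/bigcupP; exists s; rewrite ?closed_nbhd_id.
have := subset_leq_card sub2; rewrite cards2 neq_vs.
have := card_closed_nbhd v reg; have := cardsID (dom_set S) (closed_nbhd v).
lia.
Qed.

(** Induction on the number of undominated vertices. A vertex [v] of least
    positive cost costs at most [k - 1] by [exists_cheap_footprinter]. If the
    undominated set is divisible, some closed neighborhood meets it without
    containing it, so [v] does not dominate all of it and the induction goes on.
    The last term is counted with its exact cost [#|T|], where the saving of the
    theorem is made. *)
Lemma greedy_extension (k : nat) (G : sgraph) (S : {set G}) :
    connected_graph G -> regular k G -> S != set0 -> dom_set S != setT ->
  exists s : seq G, exists T : {set G},
    [/\ footprinting (dom_set S) s, 0 < size s, indivisible T, T != set0
      & #|G| <= #|dom_set S| + (size s).-1 * k.-1 + #|T|].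
Proof.
move=> conn reg; have [d] := ubnP #|~: dom_set S|.
elim: d S => // d IHd S lt_d S0 ST; have [v0 new_v0 cheap_v0] :=
  exists_cheap_footprinter conn reg S0 ST.
pose new (v : G) := #|closed_nbhd v :\: dom_set S|.
have new_gt0 v : (0 < new v) = ~~ (closed_nbhd v \subset dom_set S).
  by rewrite card_gt0 setD_eq0.
have newE v : new v = #|~: dom_set S :&: closed_nbhd v|.
  by rewrite /new setDE setIC.
have [unsT|] := boolP (indivisible (~: dom_set S)).
  exists [:: v0], (~: dom_set S); split=> //=; first by rewrite new_v0.
    by rewrite -subset0 subCset setC0 subTset.
  by rewrite addn0 cardsC.
rewrite negb_forall => /existsP[v1]; rewrite negb_or => /andP[spl1 meet1].
have new_v1 : 0 < new v1.
  rewrite newE card_gt0 setIC; apply: contra meet1 => /eqP e.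
  by rewrite -setI_eq0 e.
pose v := [arg min_(v < v1 | 0 < new v) new v].
have [v_gt0 v_min] : 0 < new v /\ forall z, 0 < new z -> new v <= new z.
  by rewrite /v; case: arg_minnP.
have le_k : new v <= k.-1 by rewrite (leq_trans (v_min v0 _)) ?new_gt0.
have lt_v : new v < #|~: dom_set S|.
  apply: leq_ltn_trans (v_min v1 new_v1) _; rewrite newE.
  apply: proper_card; rewrite properE subsetIl /=.
  by apply: contra spl1 => /subsetIP[].
have domE : dom_set (v |: S) = dom_set S :|: closed_nbhd v.
  by rewrite /dom_set bigcup_setU big_set1 setUC.
have card_dom : #|dom_set (v |: S)| = #|dom_set S| + new v.
  rewrite domE cardsU /new cardsD setIC.
  have := subset_leq_card (subsetIl (closed_nbhd v) (dom_set S)).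
  lia.
have := cardsC (dom_set S); have := cardsC (dom_set (v |: S)) => cC' cC.
have [|||s [T [fp_s s_gt0 unsT T0 le_n]]] := IHd (v |: S).
- lia.
- by apply/set0Pn; exists v; rewrite !inE eqxx.
- apply/eqP=> e; move: card_dom; rewrite e cardsT; lia.
exists (v :: s), T; split=> //=; first by rewrite -new_gt0 v_gt0 -domE.
case: (size s) s_gt0 le_n => //= m _; rewrite card_dom mulSn; lia.
Qed.

(** * Parity and isomorphism with complete graphs *)

Lemma regular_handshake (k : nat) (G : sgraph) :
  regular k G -> ~~ odd (#|G| * k).
Proof.
move=> reg.
pose up (v w : G) : nat := adj v w && (enum_rank v < enum_rank w).
suff -> : #|G| * k = (\sum_v \sum_w up v w).*2 by rewrite odd_double.
rewrite -addnn [in X in _ + X]exchange_big -big_split -sum_nat_const /=.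
apply: eq_bigr => v _; rewrite -(reg v) -big_split -sum1dep_card big_mkcond /=.
apply: eq_bigr => w _; rewrite /up [adj w v]adj_sym.
have [vw|//] := boolP (adj v w); case: ltngtP => //= /ord_inj/enum_rank_inj e.
by rewrite e adj_irr in vw.
Qed.

Lemma isomorphic_complete (k : nat) (G : sgraph) (u : G) :
  regular k G -> closed_nbhd u = setT -> isomorphic G (complete_graph k.+1).
Proof.
move=> reg uT; have cardG : #|G| = k.+1.
  by rewrite -(card_closed_nbhd u reg) uT cardsT.
have allT (v : G) : closed_nbhd v = setT.
  by apply/eqP; rewrite eqEcard subsetT cardsT cardG (card_closed_nbhd v reg) /=.
exists (fun v => cast_ord cardG (enum_rank v)).
  by apply: bij_comp; [exists (cast_ord (esym cardG));
    [exact: cast_ordK | exact: cast_ordKV] | exact: enum_rank_bij].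
move=> v w /=; rewrite (inj_eq (@cast_ord_inj _ _ _)) (inj_eq enum_rank_inj).
have := in_setT w; rewrite -(allT v) in_closed_nbhd eq_sym.
by case: eqP => //= -> _; rewrite adj_irr.
Qed.

(** * Graphs without a closed neighborhood sequence of length three *)

(** A vertex [v] that dominates some, but not all, of the vertices left by [x]
    can be followed by a vertex [y] that both leave: [x, v, y] has length 3. *)
Lemma indivisible_non_nbhd (G : sgraph) (x : G) :
  grundy_dom G < 3 -> indivisible (~: closed_nbhd x).
Proof.
apply: contraTT; rewrite -leqNgt negb_forall => /existsP[v].
rewrite negb_or => /andP[/subsetPn[y xy vy]].
rewrite disjoints_subset setCK => v_new.
apply: (@footprinting_leq_grundy G [:: x; v; y]) => /=.
rewrite !set0U v_new andbT; apply/andP; split.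
  by apply/subsetPn; exists x; rewrite ?closed_nbhd_id ?in_set0.
apply/subsetPn; exists y; rewrite ?closed_nbhd_id // in_setU negb_or vy andbT.
by rewrite in_setC in xy.
Qed.

(** Conversely to [indivisible_sub_twin_class], a twin of a non-neighbor of [x]
    is again a non-neighbor of [x]. *)
Lemma twin_class_non_nbhd (G : sgraph) (x y : G) :
    grundy_dom G < 3 -> y \notin closed_nbhd x ->
  twin_class y = ~: closed_nbhd x.
Proof.
move=> gr xy; apply/eqP; rewrite eqEsubset; apply/andP; split; last first.
  by apply: indivisible_sub_twin_class; rewrite ?indivisible_non_nbhd // in_setC.
apply/subsetP=> t; rewrite inE in_setC => /eqP tw.
by rewrite closed_nbhd_sym tw -closed_nbhd_sym.
Qed.

Lemma dvdn_card_twin_class (p : nat) (G : sgraph) :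
  (forall x : G, #|twin_class x| = p) -> p %| #|G|.
Proof.
move=> unif; rewrite -cardsT.
rewrite (@card_uniform_partition _ p (preim_partition (@closed_nbhd G) setT)).
- exact: dvdn_mull.
- move=> A /imsetP[x _ ->]; rewrite -(unif x); apply: eq_card => y.
  by rewrite !inE eq_sym.
- exact: preim_partitionP.
Qed.

(** In the complement graph every vertex has two neighbors, and vertices with a
    common neighbor have the same neighbors; so each component is a 4-cycle. *)
Lemma isomorphic_complement_2C4 (G : sgraph) :
    #|G| = 8 -> (forall x : G, #|~: closed_nbhd x| = 2) ->
    (forall x y : G, y \notin closed_nbhd x ->
       twin_class y = ~: closed_nbhd x) ->
  isomorphic G (complement two_C4).
Proof.
move=> cardG card2 twE; pose X (x : G) := ~: closed_nbhd x.
have Xsym x y : (y \in X x) = (x \in X y) by rewrite !in_setC closed_nbhd_sym.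
have Xid x : x \notin X x by rewrite in_setC closed_nbhd_id.
have XE x y z : y \in X x -> z \in X x -> X y = X z.
  rewrite !in_setC => /twE tw; rewrite -in_setC -tw inE => /eqP.
  by rewrite /X => ->.
have pair x y : y \in X x -> exists2 y', y != y' & X x = [set y; y'].
  rewrite /X; have /eqP/cards2P[a [b [neq_ab ->]]] := card2 x.
  case/set2P=> ->; first by exists b.
  by exists a; rewrite ?(eq_sym b) // setUC.
have pickX x : exists y, y \in X x.
  by apply/set0Pn; rewrite -card_gt0 card2.
(* The component of [u] in the complement graph is the cycle u, y, u', y'. *)
have cycle u : exists y u' y',
    [/\ uniq [:: u; y; u'; y'], X u = [set y; y'], X y = [set u; u'],
        X u' = [set y; y'] & X y' = [set u; u']].
  have [y uy] := pickX u; have yu : u \in X y by rewrite Xsym.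
  have [y' yy' Xu] := pair u y uy; have [u' uu' Xy] := pair y u yu.
  have uy' : y' \in X u by rewrite Xu set22.
  have yu' : u' \in X y by rewrite Xy set22.
  have Xu' : X u' = X u by apply: XE yu' yu.
  have Xy' : X y' = X y by apply: XE uy' uy.
  exists y, u', y'; split; rewrite ?Xu' ?Xy' //=.
  rewrite !inE !negb_or uu' yy' !andbT /=; apply/and3P; split.
  - by apply/andP; split; apply: contraNneq (Xid u) => {1}->.
  - by apply: contraNneq (Xid y) => {1}->.
  - by apply: contraNneq (Xid y') => e; rewrite -{1}e Xy'.
have u : G by apply: enum_val (cast_ord (esym cardG) ord0).
have [y [u' [y' [uniq1 Xu Xy Xu' Xy']]]] := cycle u.
have [z zout] : exists z, z \notin X u :|: X y.
  apply/existsP; rewrite -negb_forall; apply/negP=> /forallP allin.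
  have : #|G| <= #|X u :|: X y| by apply/subset_leq_card/subsetP=> x _.
  by rewrite cardG cardsU !card2; lia.
have out a b : a \notin X u :|: X y -> b \in X a -> b \notin X u :|: X y.
  have uy : y \in X u by rewrite Xu set21.
  rewrite !in_setU !negb_or => /andP[ua ya] ab; apply/andP; split.
    by apply: contra ya => ub; rewrite -(XE u b y ub uy) Xsym.
  by apply: contra ua => yb; rewrite -(XE y b u yb) Xsym // Xsym.
have [w [z' [w' [uniq2 Xz Xw Xz' Xw']]]] := cycle z.
have wout : w \notin X u :|: X y by apply: out zout _; rewrite Xz set21.
have w'out : w' \notin X u :|: X y by apply: out zout _; rewrite Xz set22.
have z'out : z' \notin X u :|: X y by apply: out wout _; rewrite Xw set22.
pose s := [:: u; y; u'; y'; z; w; z'; w'].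
have uniq_s : uniq s.
  rewrite -[s]/([:: u; y; u'; y'] ++ [:: z; w; z'; w']) cat_uniq uniq1 uniq2.
  have inE1 a : a \in [:: u; y; u'; y'] = (a \in X u :|: X y).
    rewrite Xu Xy !inE; by do 4!case: (a == _).
  by rewrite /= !inE1 !negb_or zout wout z'out w'out.
(* [o1] and [o2] list the positions in [s] of the two non-neighbors of each
   entry of [s]. *)
pose o1 := [:: 1; 0; 1; 0; 5; 4; 5; 4]; pose o2 := [:: 3; 2; 3; 2; 7; 6; 7; 6].
have XsE i : i < 8 ->
    X (nth u s i) = [set nth u s (nth 0 o1 i); nth u s (nth 0 o2 i)].
  by move: i; do 8![case=> //].
have adjE i j : i < 8 -> j < 8 ->
    adj (nth u s i) (nth u s j) =
    [&& j != i, j != nth 0 o1 i & j != nth 0 o2 i].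
  move=> lti ltj; have : adj (nth u s i) (nth u s j) =
      (nth u s j != nth u s i) && (nth u s j \notin X (nth u s i)).
    rewrite in_setC negbK in_closed_nbhd.
    by case: eqP => // ->; rewrite adj_irr.
  have lto : nth 0 o1 i < 8 /\ nth 0 o2 i < 8.
    by move: i lti; do 8![case=> //].
  by case: lto => lt1 lt2; rewrite XsE // !inE !nth_uniq // negb_or.
pose idx (a : complement two_C4) : nat :=
  match a with inl i => val i | inr i => 4 + val i end.
have idx_lt a : idx a < 8 by case: a => -[i /= lti]; lia.
pose g a := nth u s (idx a).
have g_inj : injective g.
  move=> a b /eqP; rewrite nth_uniq ?idx_lt // => /eqP.
  by case: a b => -[i lti] [] [j ltj] /=;
    [move=> e; congr inl | lia | lia | move/addnI=> e; congr inr]; apply: val_inj.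
have g_adj a b : adj (g a) (g b) = adj a b.
  rewrite adjE ?idx_lt //.
  by case: a => -[[|[|[|[|i]]]] lti] //; case: b => -[[|[|[|[|j]]]] ltj].
have cardH : #|complement two_C4| = 8 by rewrite card_sum !card_ord.
have [f gK fK] : bijective g by apply: inj_card_bij; rewrite // cardG cardH.
exists f; first by exists g.
by move=> v v'; rewrite -g_adj !fK.
Qed.

(** * The lower bound *)

(** For [w] take a neighbor of [u] that has a neighbor outside of [N[u]]. It is
    not a twin of [u], so it adds one to the [#|twin_class u|] common elements
    that [N[u]] and [N[w]] already have. *)
Lemma exists_cheap_start (k : nat) (G : sgraph) (u : G) :
    connected_graph G -> regular k G -> closed_nbhd u != setT ->
  exists2 w, footprinting set0 [:: u; w]
           & #|dom_set [set u; w]| + #|twin_class u| <= k.*2.+1.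
Proof.
move=> conn reg uT; have u0 : closed_nbhd u != set0.
  by apply/set0Pn; exists u; rewrite closed_nbhd_id.
have [w uw [y uy wy]] := exists_boundary_edge conn u0 uT.
have wy' : y \in closed_nbhd w by rewrite in_closed_nbhd wy orbT.
exists w.
  rewrite /= !set0U subset0 u0 andbT /=.
  by apply/subsetPn; exists y.
have sub : w |: twin_class u \subset closed_nbhd u :&: closed_nbhd w.
  apply/subsetP=> t; rewrite in_setI => /setU1P[->|].
    by rewrite uw closed_nbhd_id.
  rewrite inE => /eqP tw.
  by rewrite -tw closed_nbhd_id closed_nbhd_sym tw.
have tw_w : w \notin twin_class u.
  by rewrite inE; apply: contraNneq uy => <-.
have := subset_leq_card sub; rewrite cardsU1 tw_w /dom_set.
rewrite bigcup_setU !big_set1 cardsU !(card_closed_nbhd _ reg).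
have := subset_leq_card (subsetIl (closed_nbhd u) (closed_nbhd w)).
rewrite (card_closed_nbhd _ reg); lia.
Qed.

(** Here [p] is the common size of the twin classes and [n = q * p]. If the bound
    fails, then [p = k./2], that is [n = 3p + 1] or [n = 3p + 2], so [p] is 1 or
    2. Then [k >= 3] leaves [(n, k) = (5, 3)], which the parity of [n * k]
    excludes, and [(n, k) = (8, 5)]. *)
Lemma grundy_lower_bound_dense (k : nat) (G : sgraph) (u : G) :
    3 <= k -> regular k G -> ~ isomorphic G (complement two_C4) ->
    closed_nbhd u != setT -> grundy_dom G < 3 ->
    #|G| + #|twin_class u| <= k.*2.+1 ->
  #|G| + uphalf k <= k.*2.
Proof.
move=> k3 reg not2C4 uT gr le_n.
have cardX (x : G) : #|~: closed_nbhd x| = #|G| - k.+1.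
  by have := cardsC (closed_nbhd x); rewrite (card_closed_nbhd x reg); lia.
have p_gt0 : 0 < #|G| - k.+1.
  rewrite -(cardX u) card_gt0; apply: contra uT => /eqP e.
  by rewrite -[closed_nbhd u]setCK e setC0.
have card_tw (x : G) : #|twin_class x| = #|G| - k.+1.
  have : 0 < #|~: closed_nbhd x| by rewrite cardX.
  case/card_gt0P=> y; rewrite in_setC -closed_nbhd_sym => xy.
  by rewrite (twin_class_non_nbhd gr xy) cardX.
have /dvdnP[q def_n] := dvdn_card_twin_class card_tw.
have even_nk := regular_handshake reg.
move: le_n; rewrite card_tw => le_n.
have [//|lt_n] := leqP (#|G| + uphalf k) k.*2.
set p := #|G| - k.+1 in def_n p_gt0 le_n *.
have def_p : #|G| = p + k.+1 by lia.
have [[n5 k3']|[n8 k5]] : (#|G| = 5 /\ k = 3) \/ (#|G| = 8 /\ k = 5).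
- have def_k : k./2 = p by lia.
  (* Since [n] is [3p + 1] or [3p + 2], [q > 3]; and [q >= 5] forces [p = 1]. *)
  have [q3|[q4|q5]] : q <= 3 \/ q = 4 \/ 5 <= q by lia.
  + nia.
  + subst q; lia.
  + nia.
- by rewrite n5 k3' in even_nk.
case: not2C4; apply: isomorphic_complement_2C4 => // [x|x y xy].
  by rewrite cardX n8 k5.
exact: twin_class_non_nbhd.
Qed.

(** The choice of [u] in a largest twin class cancels the unknown size [#|T|] of
    the last cost against the saving on the second term. *)
Lemma grundy_lower_bound (k : nat) (G : sgraph) :
    3 <= k -> connected_graph G -> regular k G ->
    ~ isomorphic G (complete_graph k.+1) ->
    ~ isomorphic G (complement two_C4) ->
  #|G| + uphalf k <= grundy_dom G * k.-1 + 2.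
Proof.
move=> k3 conn reg notK not2C4; have [/card_gt0P[u0 _] _] := conn.
have nbhdT (v : G) : closed_nbhd v != setT.
  by apply/eqP=> /(isomorphic_complete reg).
have [u _ u_max] := @arg_maxnP _ u0 xpredT (fun v : G => #|twin_class v|) isT.
have [w fp_uw card_uw] := exists_cheap_start conn reg (nbhdT u).
have domE : dom_set [set u; w] = closed_nbhd u :|: closed_nbhd w.
  by rewrite /dom_set bigcup_setU !big_set1.
have [domT|domT] := eqVneq (dom_set [set u; w]) setT.
  move: card_uw; rewrite domT cardsT => card_uw.
  have [gr3|gr3] := leqP 3 (grundy_dom G).
    have : 0 < #|twin_class u| by apply/card_gt0P; exists u; rewrite inE.
    have : 3 * k.-1 <= grundy_dom G * k.-1 by rewrite leq_mul2r gr3 orbT.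
    lia.
  have := grundy_lower_bound_dense k3 reg not2C4 (nbhdT u) gr3 card_uw.
  have : 2 * k.-1 <= grundy_dom G * k.-1.
    by rewrite leq_mul2r (footprinting_leq_grundy fp_uw) orbT.
  lia.
have uw0 : [set u; w] != set0 by apply/set0Pn; exists u; rewrite set21.
have [s [T [fp_s s_gt0 indT /set0Pn[t Tt] le_n]]] :=
  greedy_extension conn reg uw0 domT.
have le_T : #|T| <= #|twin_class u|.
  apply: leq_trans (subset_leq_card (indivisible_sub_twin_class indT Tt))
    (u_max t isT).
have le_s : size s + 2 <= grundy_dom G.
  rewrite addnC; apply: (@footprinting_leq_grundy G [:: u, w & s]).
  by move: fp_uw => /= /and3P[-> -> _]; rewrite set0U -domE.
have le_sk : (size s + 2) * k.-1 <= grundy_dom G * k.-1.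
  by rewrite leq_mul2r le_s orbT.
have sk : (size s).-1 * k.-1 + k.-1 = size s * k.-1.
  by rewrite -mulSnr prednK.
rewrite mulnDl in le_sk.
have [k4|k_le3] := leqP 4 k; first by lia.
have k_eq3 : k = 3 by lia.
have := regular_handshake reg; rewrite oddM k_eq3 andbT => even_n.
subst k; lia.
Qed.

Lemma ceil_half (k : nat) : Num.ceil (k%:R / 2%:R : rat)%R = Posz (uphalf k).
Proof.
apply: ceil_def; rewrite ltr_pdivlMr ?ltr0n // ler_pdivrMr ?ltr0n //.
have castE (z : int) : (z%:~R * 2%:R = (z * 2)%:~R :> rat)%R by rewrite intrM.
by rewrite !castE !pmulrn ler_int ltr_int; lia.
Qed.

Local Open Scope ring_scope.

Theorem theorem2p1 (k : nat) (G : sgraph)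
    (k_ge3 : (3 <= k)%N)
    (G_connected : connected_graph G)
    (G_regular : regular k G)
    (G_not_complete : ~ isomorphic G (complete_graph k.+1))
    (G_not_compl_2C4 : ~ isomorphic G (complement two_C4)) :
  ((#|G|%:R + (Num.ceil (k%:R / 2%:R : rat))%:~R - 2%:R) / (k%:R - 1) : rat)
    <= (grundy_dom G)%:R.
Proof.
have k1 : k%:R - 1 = k.-1%:R :> rat by rewrite -subn1 natrB //; lia.
have bound := grundy_lower_bound k_ge3 G_connected G_regular
  G_not_complete G_not_compl_2C4.
rewrite ceil_half k1 ler_pdivrMr ?ltr0n; last by lia.
by rewrite lerBlDr -natrM -!natrD ler_nat.
Qed.
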